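(* Let $\mathbb{R}^+$ denote the set of positive real numbers. The 2-periodic $\mathbb{R}^+$-friezes of Dynkin types $A$, $D$, $E$ are classified as follows. (1) For each of the types $A_n$ with $n\ge 2$ even, $E_6$ and $E_8$, every 2-periodic $\mathbb{R}^+$-frieze is constant. (2) For each of the types $A_n$ with $n\ge 1$ odd, $D_n$ with $n\ge 5$ odd, and $E_7$, the 2-periodic $\mathbb{R}^+$-friezes form a one-parameter family. (3) For each type $D_n$ with $n\ge 4$ even, the 2-periodic $\mathbb{R}^+$-friezes form a two-parameter family.
   Context: Let $\Delta$ be a simply laced Dynkin diagram (type $A_n$ for $n\ge1$, $D_n$ for $n\ge4$, $E_6$, $E_7$ or $E_8$) with vertex set $I$. Write $j\sim i$ if $i,j\in I$ are adjacent in $\Delta$. Since $\Delta$ is a tree, fix $\varepsilon: I\to\{0,1\}$ such that $\varepsilon(i)\neq\varepsilon(j)$ whenever $i\sim j$. Let $V=\{(i,k)\in I\times\mathbb{Z} : k\equiv\varepsilon(i) \pmod 2\}$. An $\mathbb{R}^+$-frieze (mesh frieze with positive real entries) of type $\Delta$ is a function $f: V\to\mathbb{R}^+$ satisfying $$ f(i,k-1)\,f(i,k+1)=1+\prod_{j\sim i} f(j,k)\qquad\text{for all } i\in I \text{ and all } k\in\mathbb{Z} \text{ with } k\equiv\varepsilon(i)+1 \pmod 2,$$ where an empty product (which occurs only in type $A_1$) equals $1$. Translating the frieze one step is the shift $k\mapsto k+2$. The frieze $f$ is constant (1-periodic) if $f(i,k+2)=f(i,k)$ for all $(i,k)\in V$,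 and it is 2-periodic if $f(i,k+4)=f(i,k)$ for all $(i,k)\in V$. In particular, constant friezes are 2-periodic. The 2-periodic $\mathbb{R}^+$-friezes of type $\Delta$ are said to form an $r$-parameter family if they are determined by $r$ freely chosen positive entries, i.e. if there is a subset $S\subset V$ with exactly $r$ elements such that the restriction map $f\mapsto f|_S$ is a bijection from the set of all 2-periodic $\mathbb{R}^+$-friezes of type $\Delta$ onto $(\mathbb{R}^+)^S$. *)

(* Defs.v *)
From HB Require Import structures.
From mathcomp Require Import all_boot all_order all_algebra finmap.
From mathcomp Require Import mathcomp_extra boolp classical_sets functions.
From mathcomp Require Import interval_inference reals.

Set Implicit Arguments.
Unset Strict Implicit.
Unset Printing Implicit Defensive.

Import Order.TTheory GRing.Theory Num.Theory.

Local Open Scope ring_scope.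

Inductive dynkin := DynA of nat | DynD of nat | DynE6 | DynE7 | DynE8.

Definition dynkin_rank (t : dynkin) : nat :=
  match t with
  | DynA n => n
  | DynD n => n
  | DynE6 => 6
  | DynE7 => 7
  | DynE8 => 8
  end.

(* The path 0 - 1 - ... - n.-2, with the extra vertex n.-1 attached to b. *)
Definition branched_edge (n b i j : nat) : bool :=
  ((i.+1 == j) && (j < n.-1)%N) || ((i == b) && (j == n.-1)).

(* Edges i - j of the diagram, listed with i < j.  The diagrams D_n (n >= 4),
   E_6, E_7, E_8 consist of three arms of lengths (n - 3, 1, 1), (2, 2, 1),
   (2, 3, 1), (2, 4, 1) glued at the branching vertex. *)
Definition dynkin_edge (t : dynkin) (i j : nat) : bool :=
  match t with
  | DynA n => i.+1 == j
  | DynD n => branched_edge n (n - 3) i j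
  | DynE6 => branched_edge 6 2 i j
  | DynE7 => branched_edge 7 2 i j
  | DynE8 => branched_edge 8 2 i j
  end.

Definition dynkin_adj (t : dynkin) : rel 'I_(dynkin_rank t) :=
  fun i j => dynkin_edge t i j || dynkin_edge t j i.

Definition bicoloring (I : finType) (adj : rel I) (eps : I -> bool) : Prop :=
  forall i j : I, adj i j -> eps i != eps j.

Definition vertex_pred (I : finType) (eps : I -> bool) : pred (I * int) :=
  fun x => (x.2 == (eps x.1 : nat)%:Z %[mod 2])%Z.

Notation vertex eps := {x | vertex_pred eps x}.

Section Frieze.
Variables (R : realType) (I : finType) (adj : rel I) (eps : I -> bool).
Implicit Types f : vertex eps -> {posnum R}.

(* f(i, k); the value 1 outside of V is a dummy, never used below. *)
Definition entry f (i : I) (k : int) : R :=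
  if insub (i, k) is Some v then (f v)%:num else 1.

Definition frieze f : Prop :=
  forall (i : I) (k : int), (k == (eps i : nat)%:Z + 1 %[mod 2])%Z ->
    entry f i (k - 1) * entry f i (k + 1) =
    1 + \prod_(j : I | adj j i) entry f j k.

(* One step of the translation is k |-> k + 2. *)
Definition periodic (p : nat) f : Prop :=
  forall (i : I) (k : int), vertex_pred eps (i, k) ->
    entry f i (k + (2 * p)%:Z) = entry f i k.

Definition frieze_family (r : nat) : Prop :=
  exists S : {fset vertex eps}, #|` S|%fset = r /\
    set_bij [set f | frieze f /\ periodic 2 f]%classic
            [set: S -> {posnum R}]%classic
            (fun f (s : S) => f (val s)).

End Frieze.

(* Main.v *)
Require Import Defs.
From HB Require Import structures.
From mathcomp Require Import all_boot all_order all_algebra finmap.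
From mathcomp Require Import mathcomp_extra boolp classical_sets functions.
From mathcomp Require Import interval_inference reals.
From mathcomp Require Import zify ring lra.

(* Writing a_i, b_i for the two entries of row i, a 2-periodic frieze is a
   positive solution of a_i b_i = 1 + prod_(j ~ i) a_j = 1 + prod_(j ~ i) b_j.
   In the coordinates x_i = sqrt(a_i b_i), r_i = sqrt(a_i / b_i) this says that
   x is a constant frieze, x_i^2 = 1 + prod_(j ~ i) x_j, and that
   prod_(j ~ i) r_j = 1 for all i, i.e. log r lies in the kernel of the adjacency
   matrix.  The constant frieze exists and is unique because the Cartan matrix
   maps some positive integer vector to a positive vector, and the dimension of
   the kernel is 0, 1 or 2 in the cases (1), (2), (3). *)

Set Implicit Arguments.
Unset Strict Implicit.
Unset Printing Implicit Defensive.

Import Order.TTheory GRing.Theory Num.Theory.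

Local Open Scope ring_scope.

(** * Constant friezes: existence and uniqueness from an integer weight *)

Section ConstantFrieze.
Variables (R : realType) (I : finType) (adj : rel I).
Implicit Types x y : I -> R.

Definition positive x : Prop := forall i, 0 < x i.

Definition constant_frieze x : Prop :=
  positive x /\ forall i, x i ^+ 2 = 1 + \prod_(j | adj j i) x j.

(** With the Cartan matrix [C = 2 - A], where [A] is the adjacency matrix, this is the system
    [C u >= 1]. It forces every [u i] to be positive. *)
Definition subadditive_weight (u : I -> nat) : Prop :=
  forall i, (1 + \sum_(j | adj j i) u j <= (u i).*2)%N.

(* Tarski's fixed point theorem: [x] is the supremum of the subsolutions, which
   are bounded by [2 ^ u i] because [1 + 2 ^ (2 u i - 1) <= 2 ^ (2 u i)]. *)
Lemma constant_frieze_exists u :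
  subadditive_weight u -> exists x, constant_frieze x.
Proof.
move=> uP.
pose F x i : R := Num.sqrt (1 + \prod_(j | adj j i) x j).
pose B i : R := 2 ^+ u i.
have u_gt0 i : (0 < u i)%N by have := uP i; lia.
have F_ge0 x : (forall i, 0 <= x i) -> forall i, 0 <= 1 + \prod_(j | adj j i) x j.
  by move=> x0 i; rewrite addr_ge0 ?ler01// prodr_ge0.
have Fmono x y : (forall i, 0 <= x i) -> (forall i, x i <= y i) ->
    forall i, F x i <= F y i.
  move=> x0 xy i; rewrite ler_wsqrtr// lerD2l ler_prod// => j _.
  by rewrite x0 xy.
have FB i : F B i <= B i.
  rewrite -(@ler_pXn2r _ 2)// ?nnegrE ?sqrtr_ge0 ?exprn_ge0//.
  rewrite sqr_sqrtr; last by apply: F_ge0 => j; rewrite exprn_ge0.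
  rewrite -expr_sum -exprM muln2; have := uP i; set s := (\sum_(j | _) _)%N => us.
  apply: (@le_trans _ _ (2 ^+ s.+1)); last by rewrite ler_weXn2l// ler1n.
  have : 1 <= 2 ^+ s :> R by rewrite exprn_ege1// ler1n.
  by rewrite exprS; lra.
(* Nonnegativity is part of [sub] because [F] is shown to be monotone on nonnegative functions
   only. *)
pose sub x := forall i, [/\ 0 <= x i, x i <= B i & x i <= F x i].
pose E i : set R := [set r | exists2 x, sub x & r = x i]%classic.
have sub0 : sub (fun=> 0).
  by move=> i; rewrite lexx sqrtr_ge0 exprn_ge0.
have E_sup i : has_sup (E i).
  split; first by exists 0, (fun=> 0).
  by exists (B i) => _ [x /(_ i)[_ xB _] ->].
pose z i := sup (E i).
have le_z x : sub x -> forall i, x i <= z i.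
  by move=> xs i; apply: sup_upper_bound => //; exists x.
have z_ge0 i : 0 <= z i by have := le_z _ sub0 i.
have z_leB i : z i <= B i.
  by apply: ge_sup; [case: (E_sup i)|move=> _ [x /(_ i)[_ xB _] ->]].
have zF i : z i <= F z i.
  apply: ge_sup; first by case: (E_sup i).
  move=> _ [x xs ->]; have [_ _ /le_trans] := xs i; apply.
  by apply: Fmono => [j|]; [have [] := xs j|exact: le_z].
have Fz i : F z i = z i.
  (* From [z <= F z] and monotonicity, [F z] is a subsolution too, so it lies below the supremum
     [z]. *)
  apply/eqP; rewrite eq_le zF andbT; apply: (le_z (F z)) => j; split.
  - exact: sqrtr_ge0.
  - by apply: le_trans (FB j); exact: Fmono.
  - exact: Fmono.
exists z; split=> i; last by rewrite -{1}Fz sqr_sqrtr// F_ge0.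
by rewrite -Fz sqrtr_gt0 ltr_pwDl// prodr_ge0.
Qed.

(* Compare at a vertex [i] maximising [(x i / y i) ^ (1 / u i)]. *)
Lemma constant_frieze_le u x y :
  subadditive_weight u -> constant_frieze x -> constant_frieze y ->
  forall i, x i <= y i.
Proof.
move=> uP [x0 xE] [y0 yE] k; rewrite leNgt; apply/negP => yxk.
pose q j : R := x j / y j.
have q0 j : 0 < q j by rewrite divr_gt0.
have q_ge0 j : 0 <= q j by rewrite ltW.
have u_gt0 i : (0 < u i)%N by have := uP i; lia.
(* A common multiple of all weights: the integral powers [q j ^+ (L %/ u j)] order the vertices as
   the roots [q j ^ (1 / u j)] do. *)
pose L := (\prod_j u j)%N.
have L_gt0 : (0 < L)%N by rewrite prodn_gt0.
have uL j : (u j * (L %/ u j) = L)%N.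
  by rewrite mulnC divnK// /L (bigD1 j)//= dvdn_mulr.
have uL_gt0 j : (0 < L %/ u j)%N.
  by have := uL j; case: (L %/ u j)%N => //; rewrite muln0; lia.
pose m j := q j ^+ (L %/ u j).
have [i mi] : exists i, forall j, m j <= m i.
  have [i _ mi] := @arg_maxP _ _ _ k predT m isT; exists i => j; exact: mi.
have qu j : q j ^+ u i <= q i ^+ u j.
  rewrite -(ler_pXn2r L_gt0) ?nnegrE ?exprn_ge0//.
  have -> : (q j ^+ u i) ^+ L = m j ^+ (u i * u j).
    by rewrite -!exprM (mulnC (u i) (u j)) mulnA (mulnC _ (u j)) uL mulnC.
  have -> : (q i ^+ u j) ^+ L = m i ^+ (u i * u j).
    by rewrite -!exprM mulnA (mulnC _ (u i)) uL mulnC.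
  by rewrite lerXn2r ?nnegrE ?exprn_ge0 ?mi.
have qi1 : 1 < q i.
  have : 1 < m i.
    by apply: lt_le_trans (mi k); rewrite exprn_egt1// -?lt0n// ltr_pdivlMr ?mul1r.
  by apply: contraTT; rewrite -!leNgt => ?; rewrite exprn_ile1// ltW.
set P := \prod_(j | adj j i) q j.
have P_gt0 : 0 < P by exact: prodr_gt0.
(* Multiplying [qu] over the neighbours bounds [P ^+ u i] by [q i] to the sum of their weights, and
   that sum is below [2 * u i]. *)
have Pq : P <= q i ^+ 2.
  rewrite -(ler_pXn2r (u_gt0 i)) ?nnegrE ?exprn_ge0 ?(ltW P_gt0)//.
  rewrite -prodrXl -exprM.
  apply: (@le_trans _ _ (\prod_(j | adj j i) q i ^+ u j)).
    by apply: ler_prod => j _; rewrite exprn_ge0 ?qu.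
  by rewrite -expr_sum ler_weXn2l ?ltW//; have := uP i; lia.
have p0 : 0 < \prod_(j | adj j i) y j by exact: prodr_gt0.
have xP : \prod_(j | adj j i) x j = P * \prod_(j | adj j i) y j.
  by rewrite -big_split; apply: eq_bigr => j _ /=; rewrite divfK ?gt_eqF.
(* Let [p] be the product of the [y j]. Then [q i ^+ 2 * (1 + p) = 1 + P * p], while
   [P <= q i ^+ 2]; hence [q i ^+ 2 <= 1], a contradiction. *)
have : q i ^+ 2 * y i ^+ 2 = x i ^+ 2 by rewrite -exprMn divfK ?gt_eqF.
rewrite xE yE xP; have : 1 < q i ^+ 2 by rewrite exprn_egt1.
by nra.
Qed.

Lemma constant_frieze_unique u x y :
  subadditive_weight u -> constant_frieze x -> constant_frieze y -> x =1 y.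
Proof.
by move=> uP xP yP i; apply/eqP; rewrite eq_le !(constant_frieze_le uP).
Qed.

End ConstantFrieze.

(** * 2-periodic friezes as pairs of a constant frieze and a balanced function *)

Section TwoPeriodic.
Variables (R : realType) (I : finType) (adj : rel I) (eps : I -> bool).
Hypothesis eps_bicol : bicoloring adj eps.
Implicit Types (f g : vertex eps -> {posnum R}) (r x a b : I -> R).

Definition balanced r : Prop :=
  positive r /\ forall i, \prod_(j | adj j i) r j = 1.

Let e i : int := (eps i : nat)%:Z.

Lemma entry_gt0 f i k : 0 < entry f i k.
Proof. by rewrite /entry; case: insub. Qed.

Lemma vertex_predD2 i k : vertex_pred eps (i, k + 2) = vertex_pred eps (i, k).
Proof. by rewrite /vertex_pred /=; lia. Qed.

Lemma entryD4 f i k (m : nat) :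
  periodic 2 f -> vertex_pred eps (i, k) -> entry f i (k + m%:Z * 4) = entry f i k.
Proof.
move=> fP; elim: m k => [|m IHm] k kP; first by rewrite mul0r addr0.
rewrite -(fP i k kP) -(IHm (k + (2 * 2)%:Z)); last first.
  by rewrite /vertex_pred /= in kP *; lia.
by congr (entry _ _ _); lia.
Qed.

Lemma entry_mod4 f i k : periodic 2 f -> vertex_pred eps (i, k) ->
  entry f i k =
    if (k == e i %[mod 4])%Z then entry f i (e i) else entry f i (e i + 2).
Proof.
move=> fP kP.
have cong4 l : (k == l %[mod 4])%Z -> entry f i k = entry f i l.
  move=> kl; have lP : vertex_pred eps (i, l) by rewrite /vertex_pred /= in kP *; lia.
  have [m klm] : exists m : int, k = l + m * 4.
    by exists ((k - l) %/ 4)%Z; lia.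
  case: m klm => m klm; first by rewrite klm entryD4.
  (* Negative multiple: [l] lies [m.+1] periods after [k], so the shift is applied at [k]. *)
  by rewrite -(@entryD4 f i k m.+1)//; congr (entry _ _ _); lia.
case: ifPn => ke; first exact: cong4.
by apply: cong4; rewrite /vertex_pred /e /= in kP ke *; lia.
Qed.

(** Modulo 4 each row has two mesh relations. Their left-hand sides are the same product in either
    order; their right-hand sides use the two columns of the neighbouring rows. *)
Lemma frieze_pairs f : periodic 2 f ->
  frieze adj f <->
  forall i, let p := entry f i (e i) * entry f i (e i + 2) in
    p = 1 + \prod_(j | adj j i) entry f j (e j) /\
    p = 1 + \prod_(j | adj j i) entry f j (e j + 2).
Proof.
move=> fP.
(* All neighbours of [i] have the opposite colour, so which of their two columns [k] hits does not
   depend on [j]. The offset 2 occurs when [eps i] holds, since the neighbours then start at column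
   0, before [e i = 1]. *)
have neighbor i j k : adj j i -> (k == e i + 1 %[mod 2])%Z ->
    entry f j k = if (k - 1 == (if eps i then e i + 2 else e i) %[mod 4])%Z
                  then entry f j (e j) else entry f j (e j + 2).
  move=> /eps_bicol ne ke; rewrite entry_mod4//.
    congr (if _ then _ else _); rewrite /e in ke *.
    by case: (eps i) (eps j) ke ne => -[]//= ke _; lia.
  by rewrite /vertex_pred /= /e in ke *;
    case: (eps i) (eps j) ke ne => -[]//= ke _; lia.
have pair i k : (k == e i + 1 %[mod 2])%Z ->
    entry f i (k - 1) * entry f i (k + 1) = entry f i (e i) * entry f i (e i + 2).
  move=> ke; rewrite (@entry_mod4 f i (k - 1)) ?(@entry_mod4 f i (k + 1))//;
    try by rewrite /vertex_pred /= /e in ke *; lia.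
  have -> : (k + 1 == e i %[mod 4])%Z = ~~ (k - 1 == e i %[mod 4])%Z by lia.
  by case: ifP => _ //=; rewrite mulrC.
split=> [fF i /=|fF i k ke].
  have k1 : (e i + 1 == e i + 1 %[mod 2])%Z by lia.
  have k3 : (e i + 3 == e i + 1 %[mod 2])%Z by lia.
  have := fF i _ k1; rewrite pair// => F1; have := fF i _ k3; rewrite pair// => F3.
  have m1 : (e i + 1 - 1 == if eps i then e i + 2 else e i %[mod 4])%Z = ~~ eps i.
    by rewrite /e; case: (eps i).
  have m3 : (e i + 3 - 1 == if eps i then e i + 2 else e i %[mod 4])%Z = eps i.
    by rewrite /e; case: (eps i).
  move: F1 F3.
  rewrite (eq_bigr _ (fun j ji => neighbor i j _ ji k1)).
  rewrite (eq_bigr _ (fun j ji => neighbor i j _ ji k3)).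
  by rewrite m1 m3; case: (eps i).
rewrite pair// (eq_bigr _ (fun j ji => neighbor i j _ ji ke)).
by have /= [pA pB] := fF i; case: (k - 1 == _ %[mod 4])%Z.
Qed.

(* At a 2-periodic frieze, [x] is the geometric mean of the two entries of a
   row and [r] the square root of their ratio. *)
Lemma frieze_polar f : frieze adj f -> periodic 2 f ->
  exists x r, [/\ constant_frieze adj x, balanced r,
    forall i, entry f i (e i) = x i * r i &
    forall i, entry f i (e i + 2) = x i / r i].
Proof.
move=> fF fP; have /(frieze_pairs fP) {fF} := fF.
set a := fun i => entry f i (e i); set b := fun i => entry f i (e i + 2).
move=> ab.
have a_gt0 i : 0 < a i by exact: entry_gt0.
have b_gt0 i : 0 < b i by exact: entry_gt0.
pose x i := Num.sqrt (a i * b i).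
have x_gt0 i : 0 < x i by rewrite sqrtr_gt0 mulr_gt0.
have x2 i : x i ^+ 2 = a i * b i by rewrite sqr_sqrtr// ltW// mulr_gt0.
(* The neighbour products of [a] and [b] agree, so both equal their geometric mean. *)
have prod_x i : \prod_(j | adj j i) x j = \prod_(j | adj j i) a j.
  have [abA abB] := ab i.
  have AB : \prod_(j | adj j i) a j = \prod_(j | adj j i) b j.
    by apply: (addrI 1); rewrite -abA abB.
  apply/eqP; rewrite -(@eqrXn2 _ 2)// ?prodr_ge0// => [|j _|j _]; try exact: ltW.
  by rewrite -prodrXl (eq_bigr _ (fun j _ => x2 j)) big_split /= -AB expr2.
exists x, (fun i => a i / x i); split=> [||i|i].
- by split=> // i; rewrite x2 prod_x; have [] := ab i.
- split=> i; first by rewrite divr_gt0.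
  by rewrite big_split /= prodfV prod_x divff// gt_eqF// prodr_gt0.
- by rewrite mulrC divfK// gt_eqF.
- by rewrite invf_div mulrA -expr2 x2 mulrC mulKf// gt_eqF.
Qed.

Lemma periodic1_of_balanced f : (forall r, balanced r -> forall i, r i = 1) ->
  frieze adj f -> periodic 2 f -> periodic 1 f.
Proof.
move=> triv fF fP; have [x [r [_ rB fe fe2]]] := frieze_polar fF fP.
move=> i k kP; rewrite (@entry_mod4 _ _ k)// (@entry_mod4 _ _ (k + _)) ?vertex_predD2//.
by rewrite fe fe2 (triv r rB) invr1 !if_same.
Qed.

Lemma eq_periodic2 f g : periodic 2 f -> periodic 2 g ->
  (forall i, entry f i (e i) = entry g i (e i)) ->
  (forall i, entry f i (e i + 2) = entry g i (e i + 2)) -> f = g.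
Proof.
move=> fP gP fg fg2; apply/funext => -[[i k] ikP]; apply/val_inj => /=.
have : entry f i k = entry g i k by rewrite (entry_mod4 fP)// (entry_mod4 gP)// fg fg2.
by rewrite /entry insubT.
Qed.

Lemma base_vertex_proof i : vertex_pred eps (i, e i).
Proof. by rewrite /vertex_pred /=. Qed.

Definition base_vertex i : vertex eps := exist _ (i, e i) (base_vertex_proof i).

Lemma entry_base f i : entry f i (e i) = (f (base_vertex i))%:num.
Proof.
rewrite /entry insubT; first exact: base_vertex_proof.
by move=> ?; congr (f _)%:num; apply: val_inj.
Qed.

Lemma base_vertex_inj : injective base_vertex.
Proof. by move=> i j []. Qed.

Definition frieze_of_pair a b (a_gt0 : positive a) (b_gt0 : positive b) :
    vertex eps -> {posnum R} :=
  fun v => if ((val v).2 == e (val v).1 %[mod 4])%Z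
           then PosNum (a_gt0 (val v).1) else PosNum (b_gt0 (val v).1).

Lemma entry_frieze_of_pair a b (a_gt0 : positive a) (b_gt0 : positive b) i k :
  vertex_pred eps (i, k) ->
  entry (frieze_of_pair a_gt0 b_gt0) i k =
    if (k == e i %[mod 4])%Z then a i else b i.
Proof.
by move=> kP; rewrite /entry insubT /frieze_of_pair /=; case: ifP.
Qed.

Lemma frieze_of_pairP a b (a_gt0 : positive a) (b_gt0 : positive b) :
  (forall i, a i * b i = 1 + \prod_(j | adj j i) a j) ->
  (forall i, a i * b i = 1 + \prod_(j | adj j i) b j) ->
  let f := frieze_of_pair a_gt0 b_gt0 in
  [/\ frieze adj f, periodic 2 f & forall i, entry f i (e i) = a i].
Proof.
move=> abA abB f.
have fP : periodic 2 f.
  move=> i k kP; rewrite !entry_frieze_of_pair//.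
    by congr (if _ then _ else _); lia.
  by rewrite /vertex_pred /= in kP *; lia.
have fa i : entry f i (e i) = a i.
  by rewrite entry_frieze_of_pair ?base_vertex_proof// eqxx.
have fb i : entry f i (e i + 2) = b i.
  rewrite entry_frieze_of_pair ?vertex_predD2 ?base_vertex_proof//.
  by case: ifP => //; lia.
split=> //; apply/(frieze_pairs fP) => i p.
rewrite /p fa fb (eq_bigr _ (fun j _ => fa j)) (eq_bigr _ (fun j _ => fb j)).
by split.
Qed.

(** The constant part [x] is unique, so the entry [x j * r j] at a base vertex carries the same
    information as [r j]. The third hypothesis gives injectivity of the restriction map and the
    fourth its surjectivity. *)
Lemma frieze_family_of_balanced (u : I -> nat) (J : seq I) :
  subadditive_weight adj u -> uniq J ->
  (forall r, balanced r -> (forall j, j \in J -> r j = 1) -> forall i, r i = 1) ->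
  (forall c, positive c ->
     exists2 r, balanced r & forall j, j \in J -> r j = c j) ->
  frieze_family R adj eps (size J).
Proof.
move=> uP Juniq Jdet Jfree.
exists [fset v in map base_vertex J]%fset; split.
  by rewrite card_fseq undup_id ?size_map// map_inj_uniq//; exact: base_vertex_inj.
set S := [fset v in _]%fset.
have inS j : j \in J -> base_vertex j \in S.
  by move=> jJ; rewrite inE /= map_f.
have [x xF] := constant_frieze_exists R uP.
have x_gt0 := xF.1.
split=> [f _ //|f g|c _].
- rewrite !inE => -[fF fP] [gF gP] fg.
  have [x1 [r [x1F rB fr fr2]]] := frieze_polar fF fP.
  have [x2 [s [x2F sB gs gs2]]] := frieze_polar gF gP.
  (* Balanced functions form a group under multiplication, so it suffices that the quotient [r / s]
     is trivial on [J]. *)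
  have rs i : r i = s i.
    have s_gt0 := sB.1 i.
    apply: (divIf (lt0r_neq0 s_gt0)); rewrite divff ?lt0r_neq0//.
    apply: (Jdet (fun i => r i / s i)) => [|j jJ].
      split=> j; first by rewrite divr_gt0 ?rB.1 ?sB.1.
      by rewrite big_split /= prodfV rB.2 sB.2 divr1.
    have := congr1 (fun h => (h [` inS j jJ]%fset)%:num) fg.
    rewrite /= -!entry_base fr gs (constant_frieze_unique uP x1F x2F).
    by move=> /(mulfI (lt0r_neq0 (x2F.1 j))) ->; rewrite divff// lt0r_neq0// sB.1.
  apply: eq_periodic2 => // i.
    by rewrite fr gs rs (constant_frieze_unique uP x1F x2F).
  by rewrite fr2 gs2 rs (constant_frieze_unique uP x1F x2F).
(* Values to prescribe for [r]: the wanted entry divided by [x i]. The default 1 only keeps [c']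
   positive away from [J]. *)
- pose c' i : R := if insub (base_vertex i) is Some s then (c s)%:num / x i else 1.
  have c'_gt0 : positive c'.
    by move=> i; rewrite /c'; case: insub => // s; rewrite divr_gt0.
  have [r rB rc] := Jfree c' c'_gt0; have r_gt0 := rB.1.
  have a_gt0 : positive (fun i => x i * r i) by move=> i; rewrite mulr_gt0.
  have b_gt0 : positive (fun i => x i / r i) by move=> i; rewrite divr_gt0.
  have ab i : x i * r i * (x i / r i) = x i ^+ 2.
    by field; rewrite gt_eqF.
  have [|i|fF fP fa] := frieze_of_pairP a_gt0 b_gt0.
  + by move=> i; rewrite ab big_split /= rB.2 mulr1 xF.2.
  + by rewrite ab big_split /= prodfV rB.2 invr1 mulr1 xF.2.
  exists (frieze_of_pair a_gt0 b_gt0) => //.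
  apply/funext => s; apply/val_inj.
  have : val s \in S := valP s.
  rewrite inE /= => /mapP[j jJ sj].
  rewrite sj -entry_base fa rc// /c' insubT; first by rewrite inS.
  move=> jS; rewrite mulrC divfK ?gt_eqF//.
  by congr (c _)%:num; apply: val_inj.
Qed.

End TwoPeriodic.

(** * Neighbour lists of Dynkin diagrams, indexed by natural numbers *)

Section DynkinNeighbors.
Variable t : dynkin.
Implicit Types i j : nat.

Definition neighbors i : seq nat :=
  [seq j <- iota 0 (dynkin_rank t) | dynkin_edge t j i || dynkin_edge t i j].

Lemma big_dynkin_adj (T : Type) (idx : T) (op : Monoid.law idx) (F : nat -> T)
    (i : 'I_(dynkin_rank t)) :
  \big[op/idx]_(j | dynkin_adj j i) F j = \big[op/idx]_(j <- neighbors i) F j.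
Proof.
rewrite big_filter -[LHS](big_mkord (fun j => dynkin_edge t j i || dynkin_edge t i j)).
by rewrite /index_iota subn0.
Qed.

Lemma subadditive_weight_dynkin (u : nat -> nat) :
  (forall i, (i < dynkin_rank t)%N ->
     (1 + \sum_(j <- neighbors i) u j <= (u i).*2)%N) ->
  exists w, subadditive_weight (@dynkin_adj t) w.
Proof.
move=> uP; exists (fun i : 'I_(dynkin_rank t) => u i) => i.
by rewrite (big_dynkin_adj _ u) uP.
Qed.

Variable R : realType.

Lemma balanced_dynkin (G : nat -> R) : (forall i, 0 < G i) ->
  (forall i, (i < dynkin_rank t)%N -> \prod_(j <- neighbors i) G j = 1) ->
  balanced (@dynkin_adj t) (fun i : 'I_(dynkin_rank t) => G i).
Proof.
move=> G_gt0 GP; split=> [i|i]; first exact: G_gt0.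
by rewrite (big_dynkin_adj _ G) GP.
Qed.

Lemma balanced_dynkin_ext (r : 'I_(dynkin_rank t) -> R) :
  balanced (@dynkin_adj t) r ->
  exists2 G : nat -> R, (forall i : 'I_(dynkin_rank t), r i = G i) &
    forall i, (i < dynkin_rank t)%N -> \prod_(j <- neighbors i) G j = 1.
Proof.
(* The value 1 outside the diagram is a dummy: [neighbors] lists vertices of the diagram only. *)
move=> [_ rP]; pose G k := if insub k is Some i then r i else 1.
have rG (i : 'I_(dynkin_rank t)) : r i = G i by rewrite /G valK.
exists G => // i it; apply: etrans (rP (Ordinal it)).
rewrite -[LHS](big_dynkin_adj _ G (Ordinal it)).
by apply: eq_bigr => j _; rewrite rG.
Qed.

End DynkinNeighbors.

(** A neighbour that exists only under a boundary condition; concatenating such lists turns products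
    over neighbours into products of conditionals. *)
Definition seq_if (b : bool) (k : nat) : seq nat := if b then [:: k] else [::].

Lemma big_seq_if (T : Type) (idx : T) (op : Monoid.law idx) (F : nat -> T) b k :
  \big[op/idx]_(j <- seq_if b k) F j = if b then F k else idx.
Proof. by case: b; rewrite ?big_seq1 ?big_nil. Qed.

Lemma mem_seq_if b k j : (j \in seq_if b k) = b && (j == k).
Proof. by case: b; rewrite ?inE. Qed.

Lemma neighbors_A n i : (i < n)%N ->
  perm_eq (neighbors (DynA n) i) (seq_if (0 < i)%N i.-1 ++ seq_if (i.+1 < n)%N i.+1).
Proof.
move=> i_n; apply: uniq_perm => [||j].
- by rewrite filter_uniq ?iota_uniq.
- by case: (ltnP 0 i); case: (ltnP i.+1 n) => //= *; rewrite inE; lia.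
- by rewrite mem_filter mem_iota mem_cat !mem_seq_if /=; lia.
Qed.

(** The path runs from 0 to [n - 2] and the leaf [n.-1] hangs on [n - 3]. The four pieces are the
    predecessor and successor on the path, and the extra edge read from each of its ends. *)
Lemma neighbors_D n i : (4 <= n)%N -> (i < n)%N ->
  perm_eq (neighbors (DynD n) i)
    (seq_if (0 < i < n.-1)%N i.-1 ++ seq_if (i < n - 2)%N i.+1
     ++ seq_if (i == n - 3)%N n.-1 ++ seq_if (i == n.-1) (n - 3)%N).
Proof.
move=> n4 i_n; apply: uniq_perm => [||j].
- by rewrite filter_uniq ?iota_uniq.
- rewrite /seq_if; do 4 case: ifP => ?; rewrite /= ?inE; lia.
- by rewrite mem_filter mem_iota !mem_cat !mem_seq_if /= /branched_edge; lia.
Qed.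

(** * Alternating sequences along a path *)

Section PathLemmas.
Variable R : realType.

(** Each step of length two inverts the value. The equivalence lets triviality travel from either
    end of the path. *)
Lemma alternating_eq1 (G : nat -> R) m :
  (forall i, (i.+2 < m)%N -> G i * G i.+2 = 1) ->
  forall k d, (k + d.*2 < m)%N -> G k = 1 <-> G (k + d.*2)%N = 1.
Proof.
move=> GP k; elim=> [|d IHd] km; first by rewrite addn0.
rewrite IHd; last by lia.
have -> : (k + d.+1.*2 = (k + d.*2).+2)%N by lia.
have : G (k + d.*2)%N * G (k + d.*2).+2 = 1 by apply: GP; lia.
by move=> GG1; split=> G1; move: GG1; rewrite G1 ?mul1r ?mulr1.
Qed.

(** The sequence [c, 1, c^-1, 1, c, ...]: powers of [c] with exponents in the kernel vector
    [1, 0, -1, 0, 1, ...] of a path with an odd number of vertices. *)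
Definition alternating (c : R) i : R :=
  if odd i then 1 else if odd i./2 then c^-1 else c.

Lemma alternating_gt0 c i : 0 < c -> 0 < alternating c i.
Proof. by move=> c0; rewrite /alternating; do 2 case: ifP => //; rewrite invr_gt0. Qed.

Lemma alternatingM c i : 0 < c -> alternating c i * alternating c i.+2 = 1.
Proof.
move=> c0; rewrite /alternating /= negbK; case: (odd i); first exact: mulr1.
by case: (odd _); rewrite /= ?mulVf ?mulfV ?gt_eqF.
Qed.

Lemma alternating1 i : alternating 1 i = 1.
Proof. by rewrite /alternating invr1 !if_same. Qed.

End PathLemmas.

(* The weights below are multiples of the sum of the fundamental weights, whose
   image under the Cartan matrix is a constant vector. *)
Lemma weight_A n :
  exists u, subadditive_weight (@dynkin_adj (DynA n)) u.
Proof.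
pose u i := (i.+1 * (n - i))%N.
apply: (@subadditive_weight_dynkin (DynA n) u) => i /= i_n.
rewrite (perm_big _ (neighbors_A i_n)) big_cat !big_seq_if /= /u.
(* Here [k] counts the vertices after [i]; this removes truncated subtraction. *)
have [k ->] : exists k, n = (i + k.+1)%N by exists (n - i.+1)%N; lia.
have -> : (i + k.+1 - i = k.+1)%N by lia.
have -> : (i + k.+1 - i.+1 = k)%N by lia.
case: i i_n => [|i] _ /=; first by case: ifP => _; lia.
have -> : (i.+1 + k.+1 - i = k.+2)%N by lia.
by case: ifP => _; nia.
Qed.

Lemma weight_D n : (4 <= n)%N -> exists u, subadditive_weight (@dynkin_adj (DynD n)) u.
Proof.
move=> n4.
(* Four times the sum of the fundamental weights, in simple-root coordinates; the scaling avoids a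
   division by 2 at the two short arms. *)
pose u i := if (i < n - 2)%N then (2 * (i.+1 * (2 * n - i.+2)))%N else (n * n.-1)%N.
apply: (@subadditive_weight_dynkin (DynD n) u) => i /= i_n.
rewrite (perm_big _ (neighbors_D n4 i_n)) !big_cat !big_seq_if /= /u.
have [m nE] : exists m, n = m.+4 by exists (n - 4)%N; lia.
move: i_n; rewrite {}nE => i_n.
case: (ltngtP i m.+1) => im.
- have [k mE] : exists k, m = (i + k)%N by exists (m - i)%N; lia.
  rewrite {}mE.
  case: i {im i_n} => [|i] /=.
    repeat case: ifP => ?; first [lia | nia].
  repeat case: ifP => ?; first [lia | nia].
- repeat case: ifP => ?; first [lia | nia].
- rewrite {}im /=.
  repeat case: ifP => ?; first [lia | nia].
Qed.

Lemma weight_E7 : exists u, subadditive_weight (@dynkin_adj DynE7) u.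
Proof.
pose u := nth 0%N [:: 34; 66; 96; 75; 52; 27; 49].
apply: (@subadditive_weight_dynkin DynE7 u).
by case=> [|[|[|[|[|[|[|]]]]]]] // _; rewrite unlock.
Qed.

(** * Balanced functions on each diagram: their determining values and their construction *)

Section Balanced.
Variable R : realType.

Lemma prod_neighbors_A n (G : nat -> R) i : (i < n)%N ->
  \prod_(j <- neighbors (DynA n) i) G j =
    (if (0 < i)%N then G i.-1 else 1) * (if (i.+1 < n)%N then G i.+1 else 1).
Proof. by move=> i_n; rewrite (perm_big _ (neighbors_A i_n)) big_cat !big_seq_if. Qed.

Lemma prod_neighbors_D n (G : nat -> R) i : (4 <= n)%N -> (i < n)%N ->
  \prod_(j <- neighbors (DynD n) i) G j =
    (if (0 < i < n.-1)%N then G i.-1 else 1) *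
    ((if (i < n - 2)%N then G i.+1 else 1) *
    ((if i == (n - 3)%N then G n.-1 else 1) *
     (if i == n.-1 then G (n - 3)%N else 1))).
Proof.
by move=> n4 i_n; rewrite (perm_big _ (neighbors_D n4 i_n)) !big_cat !big_seq_if.
Qed.

(** Vertex 0 has at most the neighbour 1, which trivialises the odd positions. The even ones are
    reached from [G 0] when [n] is odd, and from the other end when [n] is even. *)
Lemma balanced_A n (G : nat -> R) :
  (forall i, (i < n)%N -> \prod_(j <- neighbors (DynA n) i) G j = 1) ->
  (odd n -> G 0%N = 1) -> forall i, (i < n)%N -> G i = 1.
Proof.
move=> GP G0 i i_n.
have GG k : (k.+2 < n)%N -> G k * G k.+2 = 1.
  move=> kn; have := GP k.+1; rewrite prod_neighbors_A/= ?kn; last by lia.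
  by apply; lia.
case: (boolP (odd i)) => i_odd.
  have -> : (i = 1 + i./2.*2)%N by lia.
  rewrite -(alternating_eq1 GG); last by lia.
  have := GP 0%N; rewrite prod_neighbors_A/=; last by lia.
  by rewrite mul1r ifT; [apply|]; lia.
case: (boolP (odd n)) => n_odd.
  have -> : (i = 0 + i./2.*2)%N by lia.
  by rewrite -(alternating_eq1 GG) ?G0//; lia.
(* The last vertex has the single neighbour [n - 2], which is an even position here. *)
rewrite (alternating_eq1 (k := i) (d := (n - 2 - i)./2) GG); last by lia.
have -> : (i + (n - 2 - i)./2.*2 = n.-1.-1)%N by lia.
have := GP n.-1; rewrite prod_neighbors_A/=; last by lia.
rewrite ifT ?ifF ?mulr1; try lia.
by apply; lia.
Qed.

Lemma balanced_A_alternating n (c : R) : odd n -> 0 < c ->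
  balanced (@dynkin_adj (DynA n)) (fun i : 'I_n => alternating c i).
Proof.
move=> n_odd c_gt0; apply: (@balanced_dynkin (DynA n)) => [i|i /= i_n].
  exact: alternating_gt0.
rewrite prod_neighbors_A//; case: (boolP (odd i)) => i_odd.
  case: i i_odd i_n => //= i i_odd i_n; rewrite ifT; last by lia.
  exact: alternatingM.
have alt_odd k : odd k -> alternating c k = 1 by rewrite /alternating => ->.
by case: i i_odd i_n => [|i] *; rewrite /= !alt_odd ?if_same ?mulr1//; lia.
Qed.

(** The leaves 0 and [n.-1] force the values at 1 and [n - 3] to be 1. For odd [n] this covers both
    parities on the path; for even [n] both positions are odd, and [G 0] supplies the other
    parity. *)
Lemma balanced_D n (G : nat -> R) : (4 <= n)%N ->
  (forall i, (i < n)%N -> \prod_(j <- neighbors (DynD n) i) G j = 1) ->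
  (~~ odd n -> G 0%N = 1) -> G (n - 2)%N = 1 -> forall i, (i < n)%N -> G i = 1.
Proof.
move=> n4 GP G0 Gn2 i i_n.
have GG k : (k.+2 < n - 2)%N -> G k * G k.+2 = 1.
  move=> kn; have := GP k.+1; rewrite prod_neighbors_D//=; last by lia.
  by repeat (case: ifP => ?; try lia); rewrite !mulr1; apply; lia.
have G1 : G 1%N = 1.
  have := GP 0%N; rewrite prod_neighbors_D//=; last by lia.
  by repeat (case: ifP => ?; try lia); rewrite ?mulr1 ?mul1r; apply; lia.
have Gn3 : G (n - 3)%N = 1.
  have := GP n.-1; rewrite prod_neighbors_D//=; last by lia.
  by repeat (case: ifP => ?; try lia); rewrite ?mulr1 ?mul1r; apply; lia.
have Gpath k : (k < n - 2)%N -> G k = 1.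
  move=> kn; case: (boolP (odd k)) => k_odd.
    have -> : (k = 1 + k./2.*2)%N by lia.
    by rewrite -(alternating_eq1 GG)//; lia.
  case: (boolP (odd n)) => n_odd.
    rewrite (alternating_eq1 (k := k) (d := (n - 3 - k)./2) GG); last by lia.
    by have -> : (k + (n - 3 - k)./2.*2 = n - 3)%N by lia.
  have -> : (k = 0 + k./2.*2)%N by lia.
  by rewrite -(alternating_eq1 GG) ?G0//; lia.
have Gn1 : G n.-1 = 1.
  (* At the branching vertex the values at [n - 4] and [n - 2] are already 1, which leaves
     [G n.-1]. *)
  have := GP (n - 3)%N; rewrite prod_neighbors_D//; last by lia.
  rewrite (Gpath (n - 3).-1); last by lia.
  have -> : (n - 3).+1 = (n - 2)%N by lia.
  rewrite Gn2 Gn3 !if_same eqxx mul1r mul1r mulr1; apply; lia.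
case: (ltnP i (n - 2)) => [/Gpath//|n2i].
by have /orP[/eqP->|/eqP->] : (i == n - 2)%N || (i == n.-1) by lia.
Qed.

(** The value at the last leaf is the one forced by the relation at the branching vertex [n - 3]. *)
Definition spin_alternating n (c s : R) i : R :=
  if (i < n - 2)%N then alternating c i
  else if i == (n - 2)%N then s else (s * alternating c (n - 4))^-1.

Lemma balanced_D_alternating n (c s : R) : (4 <= n)%N -> 0 < c -> 0 < s ->
  (odd n -> c = 1) ->
  balanced (@dynkin_adj (DynD n)) (fun i : 'I_n => spin_alternating n c s i).
Proof.
move=> n4 c_gt0 s_gt0 n_odd.
apply: (@balanced_dynkin (DynD n) R (spin_alternating n c s)) => [i|i /= i_n].
  rewrite /spin_alternating; case: ifP => _; first exact: alternating_gt0.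
  case: ifP => // _.
  by rewrite invr_gt0 mulr_gt0// alternating_gt0.
(* This is the relation at both short arms. It holds by parity for even [n], and for odd [n] because
   [c = 1]. *)
have alt_n3 : alternating c (n - 3) = 1.
  case: (boolP (odd n)) => [/n_odd->|n_even]; first exact: alternating1.
  by rewrite /alternating ifT//; lia.
rewrite prod_neighbors_D// /spin_alternating.
case: (ltngtP i (n - 3)%N) => i_n3.
- rewrite (@ifF _ (i == n.-1)) ?(@ifT _ (i < n - 2)%N) ?mulr1; try lia.
  case: i i_n i_n3 => [|i] i_n i_n3 /=.
    by rewrite ifT ?mul1r //; lia.
  by rewrite !ifT ?alternatingM//; lia.
- rewrite (@ifF _ (i < n - 2)%N) ?mul1r; try lia.
  case: (i == n.-1) / eqP => i_n1.
    by rewrite ifF ?ifT ?alt_n3 ?mulr1//; lia.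
  rewrite !ifT ?mulr1; try lia.
  by have -> : i.-1 = (n - 3)%N by lia.
- rewrite {}i_n3 !(@ifT _ (n - 3 < n - 2)%N) ?(@ifT _ (0 < n - 3 < n.-1)%N); try lia.
  have -> : (n - 3).-1 = (n - 4)%N by lia.
  have -> : (n - 3).+1 = (n - 2)%N by lia.
  rewrite ltnn eqxx (@ifT _ (n - 4 < n - 2)%N) 1?(@ifF _ (n.-1 < n - 2)%N); try lia.
  rewrite (@ifF _ (n.-1 == n - 2)%N) 1?(@ifF _ (n - 3 == n.-1)%N) ?mulr1; try lia.
  have := alternating_gt0 (n - 4) c_gt0 => ?.
  by field; rewrite !gt_eqF.
Qed.

(** For the exceptional diagrams the neighbour list is written out as [s] and checked by
    computation. *)
Lemma prod_neighbors_at t (s : seq nat) (G : nat -> R) i :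
  (forall i, (i < dynkin_rank t)%N -> \prod_(j <- neighbors t i) G j = 1) ->
  (i < dynkin_rank t)%N -> neighbors t i = s -> \prod_(j <- s) G j = 1.
Proof. by move=> GP it <-; exact: GP. Qed.

(** The leaves 0, 5, 4 trivialise their neighbours 1, 2, 3; the relations at 1, 3 and 2 then give 0,
    4 and 5. *)
Lemma balanced_E6 r : balanced (@dynkin_adj DynE6) r -> forall i, r i = 1 :> R.
Proof.
move=> /balanced_dynkin_ext[G rG GP] [i i_6]; rewrite rG /= {r rG}.
have at_ k s := @prod_neighbors_at DynE6 s G k GP.
have := at_ 0%N [:: 1%N] isT erefl; rewrite big_seq1 => G1.
have := at_ 5%N [:: 2%N] isT erefl; rewrite big_seq1 => G2.
have := at_ 4%N [:: 3%N] isT erefl; rewrite big_seq1 => G3.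
have := at_ 1%N [:: 0%N; 2%N] isT erefl.
rewrite !big_cons big_nil G2 !mulr1 => G0.
have := at_ 3%N [:: 2%N; 4%N] isT erefl.
rewrite !big_cons big_nil G2 mul1r !mulr1 => G4.
have := at_ 2%N [:: 1%N; 3%N; 5%N] isT erefl.
rewrite !big_cons big_nil G1 G3 !mul1r !mulr1 => G5.
by case: i i_6 => [|[|[|[|[|[|]]]]]].
Qed.

(** The leaves 0, 7, 6 trivialise 1, 2, 5; the relations at 1, 3, 5, 4, 2 then give 0, 4, 6, 3, 7 in
    turn. *)
Lemma balanced_E8 r : balanced (@dynkin_adj DynE8) r -> forall i, r i = 1 :> R.
Proof.
move=> /balanced_dynkin_ext[G rG GP] [i i_8]; rewrite rG /= {r rG}.
have at_ k s := @prod_neighbors_at DynE8 s G k GP.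
have := at_ 0%N [:: 1%N] isT erefl; rewrite big_seq1 => G1.
have := at_ 7%N [:: 2%N] isT erefl; rewrite big_seq1 => G2.
have := at_ 6%N [:: 5%N] isT erefl; rewrite big_seq1 => G5.
have := at_ 1%N [:: 0%N; 2%N] isT erefl.
rewrite !big_cons big_nil G2 !mulr1 => G0.
have := at_ 3%N [:: 2%N; 4%N] isT erefl.
rewrite !big_cons big_nil G2 mul1r !mulr1 => G4.
have := at_ 5%N [:: 4%N; 6%N] isT erefl.
rewrite !big_cons big_nil G4 mul1r !mulr1 => G6.
have := at_ 4%N [:: 3%N; 5%N] isT erefl.
rewrite !big_cons big_nil G5 !mulr1 => G3.
have := at_ 2%N [:: 1%N; 3%N; 7%N] isT erefl.
rewrite !big_cons big_nil G1 G3 !mul1r !mulr1 => G7.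
by case: i i_8 => [|[|[|[|[|[|[|[|]]]]]]]].
Qed.

Lemma balanced_E7 r : balanced (@dynkin_adj DynE7) r ->
  r ord_max = 1 :> R -> forall i, r i = 1.
Proof.
move=> /balanced_dynkin_ext[G rG GP]; rewrite rG /= => G6 [i i_7]; rewrite rG /= {r rG}.
have at_ k s := @prod_neighbors_at DynE7 s G k GP.
have := at_ 0%N [:: 1%N] isT erefl; rewrite big_seq1 => G1.
have := at_ 6%N [:: 2%N] isT erefl; rewrite big_seq1 => G2.
have := at_ 5%N [:: 4%N] isT erefl; rewrite big_seq1 => G4.
have := at_ 1%N [:: 0%N; 2%N] isT erefl.
rewrite !big_cons big_nil G2 !mulr1 => G0.
have := at_ 2%N [:: 1%N; 3%N; 6%N] isT erefl.
rewrite !big_cons big_nil G1 G6 !mul1r !mulr1 => G3.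
have := at_ 4%N [:: 3%N; 5%N] isT erefl.
rewrite !big_cons big_nil G3 mul1r !mulr1 => G5.
by case: i i_7 => [|[|[|[|[|[|[|]]]]]]].
Qed.

Lemma balanced_E7_exists (c : R) : 0 < c ->
  exists2 r, balanced (@dynkin_adj DynE7) r & r ord_max = c.
Proof.
(* With [c] at vertex 6, the relation at 2 forces [c^-1] at 3, and the relation at 4 then forces [c]
   at 5. *)
move=> c_gt0; pose G := nth 1 [:: 1; 1; 1; c^-1; 1; c; c].
exists (fun i : 'I_7 => G i) => //; apply: (@balanced_dynkin DynE7 R G) => i.
  by do 7! [case: i => [|i]; first by rewrite /= ?invr_gt0]; rewrite /G nth_default.
have cc : c * c^-1 = 1 by rewrite divff// gt_eqF.
do 7! [case: i => [|i]; first by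
  rewrite unlock /= /G /= ?mulr1 ?mul1r ?(mulrC c^-1) ?mulr1 ?cc].
by [].
Qed.

End Balanced.

Theorem theorem1p1 (R : realType) (t : dynkin)
    (eps : 'I_(dynkin_rank t) -> bool)
    (eps_bicoloring : bicoloring (@dynkin_adj t) eps) :
  [/\ (exists n : nat, [/\ (2 <= n)%N, ~~ odd n & t = DynA n]) \/
        t = DynE6 \/ t = DynE8 ->
      forall f : vertex eps -> {posnum R},
        frieze (@dynkin_adj t) f -> periodic 2 f -> periodic 1 f,
      (exists n : nat, [/\ (1 <= n)%N, odd n & t = DynA n]) \/
        (exists n : nat, [/\ (5 <= n)%N, odd n & t = DynD n]) \/
        t = DynE7 ->
      frieze_family R (@dynkin_adj t) eps 1
    & (exists n : nat, [/\ (4 <= n)%N, ~~ odd n & t = DynD n]) ->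
      frieze_family R (@dynkin_adj t) eps 2].
Proof.
split.
- move=> tE f; apply: (periodic1_of_balanced eps_bicoloring).
  case: tE => [[n [_ n_even ->]]|[]->] r.
  + move=> /balanced_dynkin_ext[G rG GP] i; rewrite rG.
    by apply: (balanced_A GP) => //; rewrite (negbTE n_even).
  + exact: balanced_E6.
  + exact: balanced_E8.
- case=> [[n [n1 n_odd tE]]|[[n [n5 n_odd tE]]|tE]]; subst t.
  + have [u uP] := weight_A n.
    apply: (frieze_family_of_balanced (J := [:: Ordinal n1]) eps_bicoloring uP) => //.
      move=> r /balanced_dynkin_ext[G rG GP] /(_ _ (mem_head _ _)).
      by rewrite rG => G0 i; rewrite rG; exact: (balanced_A GP).
    move=> c c_gt0; exists (fun i : 'I_n => alternating (c (Ordinal n1)) i).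
      exact: balanced_A_alternating.
    by move=> j; rewrite inE => /eqP->.
  + have n4 : (4 <= n)%N by lia.
    have [u uP] := weight_D n4; have n2 : (n - 2 < n)%N by lia.
    (* The free entry sits on the short arm [n - 2], since for odd [n] the long path is trivial. *)
    apply: (frieze_family_of_balanced (J := [:: Ordinal n2]) eps_bicoloring uP) => //.
      move=> r /balanced_dynkin_ext[G rG GP] /(_ _ (mem_head _ _)).
      rewrite rG => Gn2 i; rewrite rG.
      by apply: (balanced_D n4 GP) => //; rewrite n_odd.
    move=> c c_gt0; exists (fun i : 'I_n => spin_alternating n 1 (c (Ordinal n2)) i).
      exact: balanced_D_alternating.
    by move=> j; rewrite inE => /eqP->; rewrite /spin_alternating ltnn eqxx.
  + have [u uP] := weight_E7.
    apply: (frieze_family_of_balanced (J := [:: ord_max]) eps_bicoloring uP) => //.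
      by move=> r rB /(_ _ (mem_head _ _)); exact: balanced_E7.
    move=> c /(_ ord_max)/balanced_E7_exists[r rB rc]; exists r => // j.
    by rewrite inE => /eqP->.
- case=> n [n4 n_even tE]; subst t.
  have [u uP] := weight_D n4.
  have n0 : (0 < n)%N by lia.
  have n2 : (n - 2 < n)%N by lia.
  (* One parameter is the alternating value along the long path, the other the value on a short
     arm. *)
  apply: (frieze_family_of_balanced (J := [:: Ordinal n0; Ordinal n2])
            eps_bicoloring uP).
  + by rewrite /= inE andbT -val_eqE /=; lia.
  + move=> r /balanced_dynkin_ext[G rG GP] rJ i; rewrite rG.
    apply: (balanced_D n4 GP) => // [_|].
      by have := rJ (Ordinal n0); rewrite rG; apply; rewrite inE eqxx.
    by have := rJ (Ordinal n2); rewrite rG; apply; rewrite !inE eqxx orbT.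
  move=> c c_gt0.
  exists (fun i : 'I_n => spin_alternating n (c (Ordinal n0)) (c (Ordinal n2)) i).
    by apply: balanced_D_alternating => //; rewrite (negbTE n_even).
  move=> j; rewrite !inE => /orP[]/eqP->; rewrite /spin_alternating /=.
    by rewrite ifT//; lia.
  by rewrite ltnn eqxx.
Qed.
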